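(* Let $H$ be a real separable Hilbert space, $T>0$ and $u_0\in H$. Assume: (1) $\mathcal K\subset H$ is a nonempty closed convex cone (so $0\in\mathcal K$); (2) $a(\cdot,\cdot),b(\cdot,\cdot):H\times H\to\mathbb R$ are continuous symmetric bilinear forms such that, for some constant $\alpha_0>0$, $a(u,u)\ge\alpha_0\|u\|^2$ and $b(u,u)\ge 0$ for all $u\in H$; (3) $j:\mathcal K\to\mathbb R$ is convex, positively homogeneous of degree $1$ (i.e. $j(\lambda x)=\lambda j(x)$ for all $\lambda>0$, $x\in\mathcal K$) and Lipschitz continuous, with $j(0)=0$; (4) $f\in W^{1,1}([0,T];H)$ and $b(u_0,v)+j(v)\ge\langle f(0),v\rangle$ for all $v\in\mathcal K$. Let $A,B:H\to H$ be the bounded linear symmetric operators defined by $\langle Au,v\rangle=a(u,v)$ and $\langle Bu,v\rangle=b(u,v)$ for all $u,v\in H$. Define $J:H\to\mathbb R\cup\{+\infty\}$ by $J(z)=j(z)$ if $z\in\mathcal K$ and $J(z)=+\infty$ if $z\notin\mathcal K$, and set $C(t):=f(t)-\partial J(0)$ for $t\in[0,T]$. Let $u:[0,T]\to H$ be a function whose derivative $\dot u(t)$ exists for a.e. $t\in[0,T]$. Then $u$ satisfies the evolution variational inequality $$\begin{cases}\dot u(t)\in\mathcal K \text{ for a.e. } t\in[0,T], \text{ and for a.e. } t\in[0,T]:\\ a(\dot u(t),v-\dot u(t))+b(u(t),v-\dot u(t))+j(v)-j(\dot u(t))\ge\langle f(t),v-\dot u(t)\rangle\quad\text{for all }v\in\mathcal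 K,\\ u(0)=u_0,\end{cases}$$ if and only if $u$ satisfies the implicit sweeping process $$-\dot u(t)\in\mathrm{N}_{C(t)}\big(A\dot u(t)+Bu(t)\big)\ \text{ for a.e. }t\in[0,T],\qquad u(0)=u_0.$$
   Context: $\langle\cdot,\cdot\rangle$ and $\|\cdot\|$ denote the inner product and norm of $H$, and $\dot u=du/dt$. For a proper convex lower semicontinuous $J:H\to\mathbb R\cup\{+\infty\}$ and $x$ with $J(x)<+\infty$, $\partial J(x)=\{\xi\in H:\langle\xi,y-x\rangle\le J(y)-J(x)\ \text{for all }y\in H\}$; in particular, here $\partial J(0)=\{\xi\in H:\langle\xi,v\rangle\le J(v)\ \text{for all }v\in H\}$. For a closed convex set $C\subset H$ and $x\in C$, $\mathrm{N}_C(x)=\{x^*\in H:\langle x^*,y-x\rangle\le0\ \text{for all }y\in C\}$, and $\mathrm{N}_C(x)=\emptyset$ if $x\notin C$. For a set $S\subset H$ and $p\in H$, $p-S=\{p-s:s\in S\}$. *)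

(* Defs.v *)
From mathcomp Require Import all_boot all_order all_algebra.
From mathcomp Require Import all_classical all_reals all_analysis.

Set Implicit Arguments.
Unset Strict Implicit.
Unset Printing Implicit Defensive.

Import Order.TTheory GRing.Theory Num.Theory.
Import numFieldNormedType.Exports.

Local Open Scope classical_set_scope.
Local Open Scope ring_scope.

Definition separable_space (X : topologicalType) : Prop :=
  exists2 S : set X, countable S & dense S.

Definition cone (R : realType) (V : lmodType R) (K : set V) : Prop :=
  forall (l : R) (x : V), 0 < l -> K x -> K (l *: x).

Section hilbert.
Context {R : realType} {H : completeNormedModType R}.
Variable dotp : {dot H for idfun}.

(* The guard [J x < +oo] makes the subdifferential empty off the domain of J;
   on the domain of a proper J the value [J x] is finite, so that [J y - J x]
   is never of the form [oo - oo]. *)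
Definition subdifferential (J : H -> \bar R) (x : H) : set H :=
  [set xi | (J x < +oo)%E /\
            forall y : H, ((dotp xi (y - x))%:E <= J y - J x)%E].

Definition normal_cone (C : set H) (x : H) : set H :=
  [set xs | C x /\ forall y : H, C y -> dotp xs (y - x) <= 0].

End hilbert.

Definition extend_pinfty {R : realType} {V : Type} (K : set V) (j : V -> R)
    (z : V) : \bar R :=
  if z \in K then (j z)%:E else +oo%E.

Section bochner.
Context {R : realType} {H : completeNormedModType R}.
Local Notation mu := (@lebesgue_measure R).

Definition simple_fun (s : R -> H) : Prop :=
  finite_set (range s) /\ forall y : H, measurable (s @^-1` [set y]).

(* Meaningful when D is measurable of finite measure, as [0, t] below. *)
Definition simple_integral (D : set R) (s : R -> H) : H :=
  \sum_(y \in range s) fine (mu (D `&` s @^-1` [set y])) *: y.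

(* g is Bochner integrable on D, with Bochner integral I. *)
Definition is_bochner_integral (D : set R) (g : R -> H) (I : H) : Prop :=
  exists s : nat -> R -> H,
    [/\ forall n, simple_fun (s n),
        {ae mu, forall t, D t -> s n t @[n --> \oo] --> g t},
        (\int[mu]_(t in D) (`|g t - s n t|)%:E)%E @[n --> \oo] --> 0%E
      & simple_integral D (s n) @[n --> \oo] --> I].

(* W^{1,1}([0, T]; H): f is (on [0, T]) the continuous representative, i.e. the
   primitive of its derivative g in L^1(0, T; H); taking t = T in the condition
   gives the integrability of g on the whole of [0, T]. *)
Definition W11 (T : R) (f : R -> H) : Prop :=
  exists g : R -> H, forall t : R, `[0, T]%classic t ->
    is_bochner_integral `[0, t]%classic g (f t - f 0).

End bochner.

(* Main.v *)
(* Put z := f(t) - A u'(t) - B u(t) and w := u'(t). For each t the variational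
   inequality says z \in dJ(w), while the sweeping process says that w is normal
   to dJ(0) at z. Homogeneity turns z \in dJ(w) into <z, w> = J(w) and
   z \in dJ(0), whence the direct implication. For the converse, let y be the
   minimizer of J + |. - (w + z)|^2 / 2 and s := w + z - y, so that s \in dJ(y).
   Normality of w tested at s gives <w, w - y> <= 0, and z \in dJ(0) tested at y
   gives <y, w - y> >= 0; hence |w - y|^2 <= 0 and z = s \in dJ(w). *)
Require Import Defs.
From mathcomp Require Import all_boot all_order all_algebra.
From mathcomp Require Import all_classical all_reals all_analysis.
From mathcomp Require Import ring lra.

Set Implicit Arguments.
Unset Strict Implicit.
Unset Printing Implicit Defensive.

Import Order.TTheory GRing.Theory Num.Theory.
Import numFieldNormedType.Exports.

Local Open Scope classical_set_scope.
Local Open Scope ring_scope.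

(** * Convexity and Lipschitz bounds restated on segments *)

Section convex_segments.
Context {R : realType} {H : completeNormedModType R}.
Implicit Types (K : set H) (j : H -> R) (t : R).

Lemma convex_set_segment {K} (x y : H) t : convex_set K ->
  0 <= t -> t <= 1 -> K x -> K y -> K (t *: x + (1 - t) *: y).
Proof.
move=> Kconvex t0 t1 Kx Ky.
by have /(_ (mem_set Kx) (mem_set Ky))/set_mem := Kconvex x y (Itv01 t0 t1).
Qed.

Lemma convex_function_segment {K j} (x y : H) t : convex_function K j ->
  0 <= t -> t <= 1 -> K x -> K y ->
  j (t *: x + (1 - t) *: y) <= t * j x + (1 - t) * j y.
Proof.
move=> jconvex t0 t1 Kx Ky.
exact: (jconvex (Itv01 t0 t1) x y (mem_set Kx) (mem_set Ky)).
Qed.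

Lemma lipschitz_onP {K j} : [lipschitz j x | x in K] ->
  exists2 L : R, 0 < L &
    forall x y, K x -> K y -> `|j x - j y| <= L * `|x - y|.
Proof.
move=> /pinfty_ex_gt0[L L0 jL]; exists L => // x y Kx Ky.
exact: (jL (x, y)).
Qed.

End convex_segments.

(** The limit t -> 0, reached by a single t: if d < c, then t = (c - d) / (2c) turns (1 - t) c into
    the midpoint of c and d, which exceeds d. *)
Lemma le_of_shrink (R : realFieldType) (c d : R) : 0 <= c ->
  (forall t, 0 < t -> t <= 1 -> (1 - t) * c <= d) -> c <= d.
Proof.
move=> c0 cd; rewrite leNgt; apply/negP => ltdc.
(* The case t = 1; it ensures that the t chosen below is at most 1. *)
have d0 : 0 <= d by have := cd 1 ltr01 (lexx _); rewrite subrr mul0r.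
have c_gt0 : 0 < c by lra.
have t0 : 0 < (c - d) / (2 * c) by rewrite divr_gt0 //; lra.
have t1 : (c - d) / (2 * c) <= 1 by rewrite ler_pdivrMr; lra.
have := cd _ t0 t1.
have -> : (1 - (c - d) / (2 * c)) * c = (c + d) / 2 by field; rewrite gt_eqF.
lra.
Qed.

Section inner_product.
Context {R : realType} {H : completeNormedModType R}.
Context (dotp : {dot H for idfun}).
Hypothesis normE : forall x : H, `|x| = Num.sqrt (dotp x x).
Implicit Types x y p q : H.

Lemma dotpC x y : dotp x y = dotp y x.
Proof. by rewrite hermC expr0 mul1r. Qed.

Lemma dotpZl (l : R) x y : dotp (l *: x) y = l * dotp x y.
Proof. exact: linearZl_LR. Qed.

Lemma dotpZr (l : R) x y : dotp x (l *: y) = l * dotp x y.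
Proof. by rewrite dotpC dotpZl dotpC. Qed.

Lemma dotpDl x y p : dotp (x + y) p = dotp x p + dotp y p.
Proof. exact: linearDl. Qed.

Lemma dotpDr x y p : dotp p (x + y) = dotp p x + dotp p y.
Proof. by rewrite dotpC dotpDl !(dotpC p). Qed.

Lemma dotpNl x y : dotp (- x) y = - dotp x y.
Proof. exact: linearNl. Qed.

Lemma dotpNr x y : dotp x (- y) = - dotp x y.
Proof. by rewrite dotpC dotpNl dotpC. Qed.

Lemma dotpBr x y p : dotp p (x - y) = dotp p x - dotp p y.
Proof. by rewrite dotpDr dotpNr. Qed.

Definition dotpE := (dotpDl, dotpDr, dotpNl, dotpNr, dotpZl, dotpZr).

Lemma sqr_norm_dotp x : `|x| ^+ 2 = dotp x x.
Proof.
rewrite normE sqr_sqrtr//; have [->|x0] := eqVneq x 0.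
  by rewrite linear0l.
exact/ltW/neq0_dnorm_gt0.
Qed.

Lemma sqr_norm_segment p q (t : R) : `|t *: p + (1 - t) *: q| ^+ 2 =
  t * `|p| ^+ 2 + (1 - t) * `|q| ^+ 2 - t * (1 - t) * `|p - q| ^+ 2.
Proof.
by rewrite !sqr_norm_dotp !dotpE (dotpC q p); ring.
Qed.

(** * Existence and optimality of the proximal point *)

Section proximal_point.
Context (K : set H) (j : H -> R) (x : H).
Hypotheses (K0 : K !=set0) (Kclosed : closed K) (Kconvex : convex_set K).
Hypotheses (jconvex : convex_function K j) (jlip : [lipschitz j x | x in K]).

Let phi y := j y + 2^-1 * `|y - x| ^+ 2.

Let phi_segment y z (t : R) : 0 <= t -> t <= 1 -> K y -> K z ->
  phi (t *: y + (1 - t) *: z) <=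
  t * phi y + (1 - t) * phi z - 2^-1 * (t * (1 - t) * `|y - z| ^+ 2).
Proof.
move=> t0 t1 Ky Kz.
have jyz := convex_function_segment jconvex t0 t1 Ky Kz.
(* The weights sum to 1, so x can be split along them; [sqr_norm_segment] then supplies the strong
   convexity term. *)
have -> : phi (t *: y + (1 - t) *: z) = j (t *: y + (1 - t) *: z) +
    2^-1 * `|t *: (y - x) + (1 - t) *: (z - x)| ^+ 2.
  congr (_ + 2^-1 * `|_| ^+ 2).
  by rewrite !scalerBr addrACA -opprD -scalerDl [t + _]addrC subrK scale1r.
rewrite sqr_norm_segment opprB addrA subrK /phi; lra.
Qed.

Let phi_lbounded : has_lbound [set phi y | y in K].
Proof.
have [L L0 jL] := lipschitz_onP jlip; have [y0 Ky0] := K0.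
(* With r = |y - x|, the Lipschitz loss L r is absorbed by r^2 / 2 + L^2 / 2. *)
exists (j y0 - L * `|x - y0| - 2^-1 * L ^+ 2) => _ [y Ky <-].
have /ler_normlP[+ _] := jL _ _ Ky Ky0; rewrite opprB => jy.
have : L * `|y - y0| <= L * (`|y - x| + `|x - y0|).
  by rewrite ler_pM2l// ler_distD.
have := sqr_ge0 (`|y - x| - L); rewrite /phi; nra.
Qed.

Let m := inf [set phi y | y in K].

Let m_le y : K y -> m <= phi y.
Proof. by move=> Ky; apply: ge_inf => //; exists y. Qed.

(** Strong convexity at the midpoint, where [phi] is still at least [m]; this makes minimizing
    sequences Cauchy. *)
Let phi_gap y z : K y -> K z ->
  2^-1 * `|y - z| ^+ 2 <= 2 * (phi y - m + (phi z - m)).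
Proof.
move=> Ky Kz; have h0 : 0 <= 2^-1 :> R by lra.
have h1 : 2^-1 <= 1 :> R by lra.
have := phi_segment h0 h1 Ky Kz.
have /m_le := convex_set_segment Kconvex h0 h1 Ky Kz.
lra.
Qed.

Let phi_minimizer : exists2 y, K y & forall v, K v -> phi y <= phi v.
Proof.
have phi_inf : has_inf [set phi y | y in K].
  by split => //; have [y Ky] := K0; exists (phi y), y.
have /choice[y_ y_P] : forall n : nat, exists y, K y /\ phi y < m + harmonic n.
  move=> n; have [_ [y Ky <-] ym] := inf_adherent (harmonic_gt0 n) phi_inf.
  by exists y.
have y_cvg : cvg (y_ @ \oo).
  apply/cauchy_cvgP/cauchy_exP => e e0.
  (* [phi_gap] bounds the squared distance by 4 times the sum of two excesses over [m], each below
     e^2 / 8. *)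
  have e8 : 0 < e ^+ 2 / 8 by rewrite divr_gt0// exprn_gt0.
  have [N _ HN] := near_infty_natSinv_lt (PosNum e8).
  exists (y_ N), N => // n /= Nn.
  have hN : harmonic N < e ^+ 2 / 8 := HN _ (leqnn N).
  have hn : harmonic n < e ^+ 2 / 8 := HN _ Nn.
  have gap : `|y_ N - y_ n| ^+ 2 < e ^+ 2.
    have := (y_P N).2; have := (y_P n).2.
    by have := phi_gap (y_P N).1 (y_P n).1; lra.
  rewrite -ball_normE /=; move: gap.
  by rewrite ltr_pXn2r ?nnegrE ?normr_ge0 ?(ltW e0).
have Ky : K (lim (y_ @ \oo)).
  apply: (@closed_cvg _ _ \oo _ y_ K Kclosed _ _ y_cvg).
  by apply: nearW => n; exact: (y_P n).1.
exists (lim (y_ @ \oo)) => // v Kv; apply: le_trans (m_le Kv).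
set y := lim _ in Ky *.
have dist_cvg : `|y_ n - y| @[n --> \oo] --> (0 : R).
  rewrite -(normr0 H) -(subrr y).
  by apply: cvg_norm; apply: cvgB => //; exact: cvg_cst.
have j_cvg : j (y_ n) @[n --> \oo] --> j y.
  have [L L0 jL] := lipschitz_onP jlip.
  apply/cvgrPdist_le => e e0.
  apply: filterS (cvgr0_norm_le _ dist_cvg _ (divr_gt0 e0 L0)) => n.
  rewrite normr_id ler_pdivlMr// mulrC distrC.
  by apply: le_trans; apply: jL => //; exact: (y_P n).1.
have phi_cvg : phi (y_ n) @[n --> \oo] --> phi y.
  apply: cvgD => //; apply: cvgM; first exact: cvg_cst.
  apply: (@continuous_cvg _ _ _ _ _ _ (fun r : R => r ^+ 2)).
    exact: exprn_continuous.
  by apply: cvg_norm; apply: cvgB => //; exact: cvg_cst.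
have mh_cvg : m + harmonic n @[n --> \oo] --> m + 0.
  by apply: cvgD; [exact: cvg_cst|exact: cvg_harmonic].
rewrite -[m]addr0; apply: (ler_cvg_to phi_cvg mh_cvg).
by near=> n; exact/ltW/(y_P n).2.
Unshelve. all: by end_near. Qed.

(** Optimality of the minimizer y: comparing it with t v + (1 - t) y, dividing by t and letting t ->
    0 gives |v - y|^2 / 2 <= phi v - phi y. Expanding the squares cancels |v - y|^2. *)
Lemma proximal_point_exists :
  exists2 y, K y & forall v, K v -> dotp (x - y) (v - y) <= j v - j y.
Proof.
have [y Ky ymin] := phi_minimizer; exists y => // v Kv.
have gap : 2^-1 * `|v - y| ^+ 2 <= phi v - phi y.
  apply: le_of_shrink => [|t t0 t1]; first by rewrite mulr_ge0// sqr_ge0.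
  rewrite -(ler_pM2l t0).
  have Kt := convex_set_segment Kconvex (ltW t0) t1 Kv Ky.
  have := le_trans (ymin _ Kt) (phi_segment (ltW t0) t1 Kv Ky).
  lra.
move: gap; rewrite /phi !sqr_norm_dotp.
rewrite !dotpE (dotpC x v) (dotpC x y) (dotpC v y).
lra.
Qed.

End proximal_point.

(** * Positively homogeneous convex functions on a cone *)

Section homogeneous.
Context (K : set H) (j : H -> R).
Hypotheses (K0 : K !=set0) (Kclosed : closed K) (Kconvex : convex_set K).
Hypothesis Kcone : cone K.
Hypotheses (jconvex : convex_function K j) (jlip : [lipschitz j x | x in K]).
Hypothesis jhom : forall (l : R) x, 0 < l -> K x -> j (l *: x) = l * j x.
Hypothesis j0 : j 0 = 0.

(** [cone] allows only positive factors, so 0 is obtained as the limit of x / (n + 1). *)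
Lemma closed_cone0 : K 0.
Proof.
have [x Kx] := K0.
apply: (@closed_cvg _ _ \oo _ (fun n => harmonic n *: x) K) => //.
  by near=> n; apply: Kcone => //; exact: harmonic_gt0.
by rewrite -[0](scale0r x); apply: cvgZr_tmp; exact: cvg_harmonic.
Unshelve. all: by end_near. Qed.

Lemma subdifferential0P s :
  subdifferential dotp (extend_pinfty K j) 0 s <->
  forall v, K v -> dotp s v <= j v.
Proof.
have J0 : extend_pinfty K j 0 = 0%E.
  by rewrite /extend_pinfty (mem_set closed_cone0) j0.
rewrite /subdifferential /= J0; split=> [[_ sJ] v Kv|sj].
  have := sJ v.
  by rewrite /extend_pinfty (mem_set Kv) subr0 sube0 lee_fin.
split=> [|v]; first exact: ltry.
rewrite subr0 sube0 /extend_pinfty; case: ifPn => [/set_mem/sj|_].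
  by rewrite lee_fin.
exact: leey.
Qed.

Lemma homogeneous_viP w z : K w ->
  (forall v, K v -> dotp z (v - w) <= j v - j w) <->
  dotp z w = j w /\ forall v, K v -> dotp z v <= j v.
Proof.
move=> Kw; split=> [vi|[zw zj] v Kv]; last first.
  by rewrite dotpBr zw lerB// zj.
have zw : dotp z w = j w.
  (* Testing with 2 w and w / 2 yields the two opposite inequalities between <z, w> and j w. *)
  have two0 : 0 < 2 :> R by lra.
  have half0 : 0 < 2^-1 :> R by lra.
  have := vi _ (Kcone two0 Kw); have := vi _ (Kcone half0 Kw).
  by rewrite !dotpBr !dotpZr !jhom//; lra.
by split=> // v /vi; rewrite dotpBr zw lerD2r.
Qed.

(** This is the inversion rule for subdifferentials: the conjugate of J is the indicator of dJ(0).
    The proximal point serves in place of biconjugation. *)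
Lemma homogeneous_vi_normal_coneP w z :
  (K w /\ forall v, K v -> dotp z (v - w) <= j v - j w) <->
  normal_cone dotp (subdifferential dotp (extend_pinfty K j) 0) z w.
Proof.
split=> [[Kw /(homogeneous_viP _ Kw)[zw zj]]|[/subdifferential0P zj wN]].
  split=> [|s /subdifferential0P sj]; first exact/subdifferential0P.
  by rewrite dotpBr 2!(dotpC w) zw subr_le0 sj.
have [y Ky yP] := proximal_point_exists (w + z) K0 Kclosed Kconvex jconvex jlip.
have [sy sj] := (homogeneous_viP _ Ky).1 yP.
have wy : dotp w ((w + z - y) - z) <= 0.
  by apply: wN; exact/subdifferential0P.
have zy := zj _ Ky.
(* By [sy] and [zy], <w - y, y> = j y - <z, y> >= 0; subtracting this from [wy] bounds the square by
   0. *)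
have : `|w - y| ^+ 2 == 0.
  rewrite eq_le sqr_ge0 andbT sqr_norm_dotp.
  by move: wy sy zy; rewrite !dotpE (dotpC y w); lra.
rewrite sqrf_eq0 normr_eq0 subr_eq0 => /eqP wy_eq.
by move: yP; rewrite wy_eq addrAC subrr add0r.
Qed.

End homogeneous.

(** The point reflection s -> p - s exchanges the two sets and reverses normal directions. *)
Lemma normal_cone_reflect (S : set H) p q w :
  normal_cone dotp [set p - s | s in S] q (- w) <->
  normal_cone dotp S (p - q) w.
Proof.
split=> [[[s Ss <-] wN]|[Spq wN]].
  rewrite subKr; split=> // r Sr.
  have : dotp (- w) (p - r - (p - s)) <= 0 by apply: wN; exists r.
  by rewrite !dotpE; lra.
split; first by exists (p - q); rewrite ?subKr.
move=> _ [r Sr <-]; have := wN _ Sr.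
by rewrite !dotpE; lra.
Qed.

End inner_product.

Theorem proposition4p2
  (R : realType)
  (* H is a real separable Hilbert space with inner product dotp *)
  (H : completeNormedModType R) (dotp : {dot H for idfun})
  (normE : forall x : H, `|x| = Num.sqrt (dotp x x))
  (sepH : separable_space H)
  (T : R) (T0 : 0 < T) (u0 : H)
  (K : set H) (K0 : K !=set0) (Kclosed : closed K) (Kconvex : convex_set K)
  (Kcone : cone K)
  (a b : {symmetric H})
  (acont : continuous (fun p : H * H => a p.1 p.2))
  (bcont : continuous (fun p : H * H => b p.1 p.2))
  (alpha0 : R) (alpha0_gt0 : 0 < alpha0)
  (acoercive : forall v : H, a v v >= alpha0 * `|v| ^+ 2)
  (bpos : forall v : H, b v v >= 0)
  (* only the values of j on K matter *)
  (j : H -> R) (jconvex : convex_function K j)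
  (jhom : forall (l : R) (x : H), 0 < l -> K x -> j (l *: x) = l * j x)
  (jlip : [lipschitz j x | x in K])
  (j0 : j 0 = 0)
  (* only the values of f on [0, T] matter *)
  (f : R -> H) (fW11 : W11 T f)
  (compat : forall v : H, K v -> b u0 v + j v >= dotp (f 0) v)
  (A B : {linear H -> H}) (Acont : continuous A) (Bcont : continuous B)
  (AE : forall v w : H, dotp (A v) w = a v w)
  (BE : forall v w : H, dotp (B v) w = b v w)
  (* only the values of u on [0, T] matter: the derivative at t in ]0, T[ does
     not see the values of u outside [0, T], and {0, T} is negligible *)
  (u : R -> H)
  (uder : {ae (@lebesgue_measure R), forall t, `[0, T]%classic t ->
             derivable u t 1}) :
  let du : R -> H := derive1 u in
  let J : H -> \bar R := extend_pinfty K j in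
  let C (t : R) : set H :=
    [set f t - s | s in subdifferential dotp J 0] in
  [/\ {ae (@lebesgue_measure R), forall t, `[0, T]%classic t ->
         K (du t)},
      {ae (@lebesgue_measure R), forall t, `[0, T]%classic t ->
         forall v : H, K v ->
           a (du t) (v - du t) + b (u t) (v - du t) + j v - j (du t) >=
           dotp (f t) (v - du t)}
    & u 0 = u0]
  <->
  {ae (@lebesgue_measure R), forall t, `[0, T]%classic t ->
     normal_cone dotp (C t) (A (du t) + B (u t)) (- du t)}
  /\ u 0 = u0.
Proof.
move=> du J C; have aeF := ae_filter_ringOfSetsType (@lebesgue_measure R).
pose z t := f t - (A (du t) + B (u t)).
have viE t v : (dotp (f t) (v - du t) <=
    a (du t) (v - du t) + b (u t) (v - du t) + j v - j (du t)) =
    (dotp (z t) (v - du t) <= j v - j (du t)).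
  by rewrite /z dotpDl dotpNl dotpDl AE BE; apply/idP/idP; lra.
have pointwise t : (K (du t) /\ forall v, K v ->
    dotp (z t) (v - du t) <= j v - j (du t)) <->
    normal_cone dotp (C t) (A (du t) + B (u t)) (- du t).
  rewrite normal_cone_reflect; exact: homogeneous_vi_normal_coneP.
(* [pointwise] holds at every t, so each direction only transfers almost-everywhere statements. *)
split=> [[duK vi u00]|[sweep u00]].
  split=> //; move: duK vi; apply: filterS2 => t duK vi t0T.
  by apply/pointwise; split=> [|v Kv]; [exact: duK|rewrite -viE vi].
split=> //; apply: filterS sweep => t /[apply] /pointwise[] // _ vi v Kv.
by rewrite viE vi.
Qed.
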